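(* For every ordinal $\alpha$ with $1\le\alpha<\omega^\omega$ and every nonnegative integer $k$, \[\overline{\mathscr{D}}(\omega^k\alpha)=\overline{\mathscr{D}}(\alpha)+k.\]
   Context: For a natural number $n$, $\|n\|$ denotes its integer complexity (the least number of $1$'s needed to write $n$ using $1$, $+$, $\cdot$ and parentheses), and $\delta(n)=\|n\|-3\log_3 n$ its defect. $\mathscr{D}=\{\delta(n):n\in\mathbb{N}\}$, and $\overline{\mathscr{D}}$ is its closure in $\mathbb{R}$; it is known that $\overline{\mathscr{D}}$ is well-ordered of order type $\omega^\omega$. Indexing convention: for a well-ordered set $S$ and an ordinal $\beta$, $S[\beta]$ denotes the element of $S$ whose set of predecessors in $S$ has order type $\beta$ (0-indexing), and for $\alpha\ge1$, $S(\alpha)$ denotes $S[\beta]$ where $\beta$ is the unique ordinal with $1+\beta=\alpha$ (1-indexing). *)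

(* Defs.v *)
From Stdlib Require Import Relation_Operators Disjoint_Union Lexicographic_Product
  Wellfounded.
From mathcomp Require Import all_boot all_order all_algebra.
From mathcomp Require Import all_classical all_reals all_analysis.

Set Implicit Arguments.
Unset Strict Implicit.
Unset Printing Implicit Defensive.

Import Order.TTheory GRing.Theory Num.Theory.
Import numFieldNormedType.Exports.
Local Open Scope classical_set_scope.
Local Open Scope ring_scope.

(** * Ordinals, as well-ordered types up to order isomorphism *)

Record wotype := WOType {
  wo_car :> Type;
  wo_lt : wo_car -> wo_car -> Prop;
  wo_trans : forall x y z, wo_lt x y -> wo_lt y z -> wo_lt x z;
  wo_total : forall x y, wo_lt x y \/ x = y \/ wo_lt y x;
  wo_wf : well_founded wo_lt }.

Arguments wo_lt {_} _ _.

(* The subset [S] of [T], ordered by [ltT], has order type [A].  As [A] is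
   linearly ordered, such an [f] is injective when [ltT] is irreflexive. *)
Definition has_order_type (T : Type) (ltT : T -> T -> Prop) (S : set T)
    (A : wotype) : Prop :=
  exists f : A -> T,
    (forall a b : A, wo_lt a b <-> ltT (f a) (f b)) /\ range f = S.

Definition ord_eq (A B : wotype) : Prop :=
  has_order_type (@wo_lt B) [set: B] A.

Definition ord_lt (A B : wotype) : Prop :=
  exists b : B, has_order_type (@wo_lt B) [set x | wo_lt x b] A.

Definition ord_le (A B : wotype) : Prop := ord_lt A B \/ ord_eq A B.

Lemma unit_trans (x y z : unit) : False -> False -> False.
Proof. by []. Qed.

Lemma unit_total (x y : unit) : False \/ x = y \/ False.
Proof. by case: x; case: y; right; left. Qed.

Lemma unit_wf : well_founded (fun _ _ : unit => False).
Proof. by move=> x; split. Qed.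

Definition ord_one : wotype := WOType unit_trans unit_total unit_wf.

Lemma nat_trans (x y z : nat) : (x < y)%N -> (y < z)%N -> (x < z)%N.
Proof. exact: ltn_trans. Qed.

Lemma nat_total (x y : nat) : (x < y)%N \/ x = y \/ (y < x)%N.
Proof. by case: (ltngtP x y) => h; [left|right; right|right; left]. Qed.

Lemma nat_wf : well_founded (fun m n : nat => (m < n)%N).
Proof.
move=> n; elim/ltn_ind: n => n IH; split=> m; exact: IH.
Qed.

Definition ord_omega : wotype := WOType nat_trans nat_total nat_wf.

Section SumProd.
Variables A B : wotype.

Let lt_sum := le_AsB A B wo_lt wo_lt.

Lemma sum_trans x y z : lt_sum x y -> lt_sum y z -> lt_sum x z.
Proof.
case=> [a b ab|a b|a b ab] h; inversion h; subst; constructor.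
- exact: wo_trans ab _.
- exact: wo_trans ab _.
Qed.

Lemma sum_total x y : lt_sum x y \/ x = y \/ lt_sum y x.
Proof.
case: x y => [a|b] [a'|b'].
- case: (wo_total a a') => [h|[->|h]]; first by left; constructor.
    by right; left.
  by right; right; constructor.
- by left; constructor.
- by right; right; constructor.
- case: (wo_total b b') => [h|[->|h]]; first by left; constructor.
    by right; left.
  by right; right; constructor.
Qed.

Lemma sum_wf : well_founded lt_sum.
Proof. by apply: wf_disjoint_sum; exact: wo_wf. Qed.

Definition ord_add : wotype := WOType sum_trans sum_total sum_wf.

(* [slexprod] makes the first component dominant: [A * B] consists of [B]
   copies of [A], so the [B]-component comes first. *)
Let lt_prod := slexprod B A wo_lt wo_lt.

Lemma prod_trans x y z : lt_prod x y -> lt_prod y z -> lt_prod x z.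
Proof.
case=> [b b' a a' bb|b a a' aa] h; inversion h; subst.
- by apply: left_slex; apply: wo_trans bb _.
- exact: left_slex.
- exact: left_slex.
- by apply: right_slex; apply: wo_trans aa _.
Qed.

Lemma prod_total x y : lt_prod x y \/ x = y \/ lt_prod y x.
Proof.
case: x y => [b a] [b' a'].
case: (wo_total b b') => [h|[->|h]]; first by left; apply: left_slex.
  case: (wo_total a a') => [h|[->|h]]; first by left; apply: right_slex.
    by right; left.
  by right; right; apply: right_slex.
by right; right; apply: left_slex.
Qed.

Lemma prod_wf : well_founded lt_prod.
Proof. by apply: wf_slexprod; exact: wo_wf. Qed.

Definition ord_mul : wotype := WOType prod_trans prod_total prod_wf.

End SumProd.

Fixpoint ord_exp (A : wotype) (k : nat) : wotype :=
  if k is k'.+1 then ord_mul (ord_exp A k') A else ord_one.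

(* [omega ^ omega] is the supremum of the [omega ^ n], for [n] finite. *)
Definition lt_omega_omega (A : wotype) : Prop :=
  exists n : nat, ord_lt A (ord_exp ord_omega n).

(** * Elements of a set of reals indexed by ordinals *)

(* [x = S[B]] *)
Definition index0 (R : realType) (S : set R) (B : wotype) (x : R) : Prop :=
  S x /\ has_order_type (fun y z : R => y < z) [set y | S y /\ y < x] B.

(* [x = S(A)]; such an [x] is unique, see [index1_unique] *)
Definition index1 (R : realType) (S : set R) (A : wotype) (x : R) : Prop :=
  exists B : wotype, ord_eq (ord_add ord_one B) A /\ index0 S B x.

Lemma wo_irr (A : wotype) (a : A) : ~ wo_lt a a.
Proof.
by elim/(well_founded_ind (@wo_wf A)): a => a IH aa; exact: (IH a aa aa).
Qed.

Lemma wo_mono_nlt (A : wotype) (h : A -> A) :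
  (forall a b, wo_lt a b -> wo_lt (h a) (h b)) -> forall a, ~ wo_lt (h a) a.
Proof.
move=> hh a; elim/(well_founded_ind (@wo_wf A)): a => a IH ha.
exact: IH ha (hh _ _ ha).
Qed.

Lemma index0_nlt (R : realType) (S : set R) (B C : wotype) (x y : R) :
  ord_eq B C -> index0 S B x -> index0 S C y -> ~ x < y.
Proof.
move=> [i [ilt iC]] [Sx [f [flt fS]]] [_ [g [glt gS]]] xy.
have preim z : S z -> z < y -> exists c, g c = z.
  move=> Sz zy; have : range g z by rewrite gS.
  by case=> c _ <-; exists c.
have fP b : S (f b) /\ f b < x.
  by have : range f (f b) := ex_intro2 _ _ b I erefl; rewrite fS.
have /choice[h hP] b : exists c, g c = f b.
  by case: (fP b) => Sb bx; apply: preim => //; apply: lt_trans xy.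
have ri c : exists b, i b = c.
  have : range i c by rewrite iC.
  by case=> b _ <-; exists b.
have [c gc] := preim x Sx xy; have [b ib] := ri c.
have hlt a : wo_lt (h a) c by apply/glt; rewrite hP gc; case: (fP a).
have /choice[j jP] := ri.
have jh_mono a a' : wo_lt a a' -> wo_lt (j (h a)) (j (h a')).
  by move=> aa'; apply/ilt; rewrite !jP; apply/glt; rewrite !hP; apply/flt.
apply: (wo_mono_nlt jh_mono (a := b)).
by apply/ilt; rewrite jP ib; exact: hlt.
Qed.

Lemma ord_eq_sym (A B : wotype) : ord_eq A B -> ord_eq B A.
Proof.
move=> [i [ilt iT]].
have /choice[j jP] b : exists a, i a = b.
  have : range i b by rewrite iT.
  by case=> a _ <-; exists a.
exists j; split=> [a b|]; first by rewrite ilt !jP.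
apply/seteqP; split=> // a _; exists (i a) => //.
have := jP (i a) => ia.
case: (wo_total (j (i a)) a) => [/ilt|[//|/ilt]];
  by rewrite ia => /wo_irr.
Qed.

Lemma ord_eq_trans (A B C : wotype) : ord_eq A B -> ord_eq B C -> ord_eq A C.
Proof.
move=> [f [flt fT]] [g [glt gT]]; exists (g \o f); split=> [a b|].
  by rewrite flt glt.
apply/seteqP; split=> // c _.
have : range g c by rewrite gT.
case=> b _ <-; have : range f b by rewrite fT.
by case=> a _ <-; exists a.
Qed.

Lemma ord_add1I (B C : wotype) :
  ord_eq (ord_add ord_one B) (ord_add ord_one C) -> ord_eq B C.
Proof.
move=> [i [ilt iT]].
have lt0 b : wo_lt (inl tt : ord_add ord_one B) (inr b) by constructor.
have lt0' c : wo_lt (inl tt : ord_add ord_one C) (inr c) by constructor.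
have nlt0 a : ~ wo_lt a (inl tt : ord_add ord_one B).
  by move=> h; inversion h.
have nlt0' a : ~ wo_lt a (inl tt : ord_add ord_one C).
  by move=> h; inversion h.
have isurj c : exists a, i a = c.
  have : range i c by rewrite iT.
  by case=> a _ <-; exists a.
have /choice[j jP] b : exists c, i (inr b) = inr c.
  case e : (i (inr b)) => [[]|c]; last by exists c.
  by have /ilt := lt0 b; rewrite e => /nlt0'.
exists j; split=> [a b|].
  have -> : wo_lt a b <-> wo_lt (inr a : ord_add ord_one B) (inr b).
    by split=> [?|h]; [constructor|inversion h].
  by rewrite ilt !jP; split=> [h|?]; [inversion h|constructor].
apply/seteqP; split=> // c _.
have [[[]|b] ib] := isurj (inr c); last first.
  by exists b => //; move: ib; rewrite jP => -[].
have [a0 ia0] := isurj (inl tt).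
by have := lt0' c; rewrite -ia0 -ib => /ilt /nlt0.
Qed.

Lemma index1_unique (R : realType) (S : set R) (A : wotype) (x y : R) :
  index1 S A x -> index1 S A y -> x = y.
Proof.
move=> [B [BA Bx]] [C [CA Cy]].
have BC : ord_eq B C.
  by apply: ord_add1I; apply: ord_eq_trans BA _; exact: ord_eq_sym.
case: (ltgtP x y) => // [|/=].
  by move/(index0_nlt BC Bx Cy).
by move/(index0_nlt (ord_eq_sym BC) Cy Bx).
Qed.

(** * Integer complexity and defect *)

Inductive expr := One | Add of expr & expr | Mul of expr & expr.

Fixpoint value (e : expr) : nat :=
  match e with
  | One => 1
  | Add e1 e2 => value e1 + value e2
  | Mul e1 e2 => value e1 * value e2
  end.

Fixpoint ones (e : expr) : nat :=
  match e with
  | One => 1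
  | Add e1 e2 | Mul e1 e2 => ones e1 + ones e2
  end.

Definition is_complexity (n k : nat) : Prop :=
  (exists e, value e = n /\ ones e = k) /\
  (forall e, value e = n -> (k <= ones e)%N).

(* No expression has value [0], and [complexity 0] is a junk value. *)
Definition complexity (n : nat) : nat := xget 0%N [set k | is_complexity n k].

Lemma complexityP (n : nat) : (0 < n)%N -> is_complexity n (complexity n).
Proof.
move=> n_gt0.
have [e0 e0n] : exists e, value e = n.
  elim: n n_gt0 => // -[_ _|n IH _]; first by exists One.
  by have [//|e en] := IH; exists (Add One e); rewrite /= en.
have exk : exists k, `[< exists e, value e = n /\ ones e = k >].
  by exists (ones e0); apply/asboolP; exists e0.
apply: (@xgetPex _ 0%N [set k | is_complexity n k]).
case: (ex_minnP exk) => k /asboolP ke kmin; exists k; split=> // e en.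
by apply: kmin; apply/asboolP; exists e.
Qed.

Definition defect (R : realType) (n : nat) : R :=
  (complexity n)%:R - 3 * (ln n%:R / ln 3).

Definition defects (R : realType) : set R :=
  [set defect R n | n in [set n : nat | (0 < n)%N]].
Arguments defects R _ : clear implicits.

(* Main.v *)
Require Import Defs.
From Stdlib Require Import Relation_Operators.
From mathcomp Require Import all_boot all_order all_algebra.
From mathcomp Require Import all_classical all_reals all_analysis.
From mathcomp Require Import zify lra ring.
Import Order.TTheory GRing.Theory Num.Theory.
Import numFieldNormedType.Exports.

Set Implicit Arguments.
Unset Strict Implicit.
Unset Printing Implicit Defensive.

Local Open Scope classical_set_scope.
Local Open Scope ring_scope.

(* In an optimal expression, an addition with value at least 4 raises the defect
   by at least [2 - 3 log_3 2] and has a bounded smaller summand, while defects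
   add up under multiplication.  So numbers of bounded defect are built from
   powers of 3 in boundedly many steps, and along an ultrafilter any sequence
   [n_j] of them satisfies [||n_j|| = C + 3 K_j] and [n_j / 3 ^ K_j -> a] from
   above, where [||a|| <= C], with equality only if [n_j = a 3 ^ K_j].  The
   defects thus converge to [C - 3 log_3 a] from below.  Hence the closure of
   the set of defects is well-ordered, and a limit point of it is a defect plus
   a positive integer.

   Conversely let [n] be stable, i.e. [||n 3 ^ k|| = ||n|| + 3 k] for all [k].
   If [(n 3 ^ j + 1) 3 ^ l] were cheaper than expected for infinitely many [j],
   the above would apply with [a 3 ^ K_j = n 3 ^ (j + l)], forcing [C = ||a||],
   so that [(n 3 ^ j + 1) 3 ^ l = n 3 ^ (j + l)], which is absurd.  So
   [delta(n) + 1] is a limit of defects of stable numbers.  Therefore the limit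
   points of the closure are exactly its elements shifted by 1, whereas in terms
   of indices they are the elements indexed by the multiples of [omega]. *)

(** * Integer complexity and stable numbers *)

Lemma value_gt0 (e : expr) : (0 < value e)%N.
Proof. by elim: e => //= e1 h1 e2 h2; rewrite ?addn_gt0 ?muln_gt0 h1 ?h2. Qed.

Lemma ones_gt0 (e : expr) : (0 < ones e)%N.
Proof. by elim: e => //= e1 h1 e2 _; rewrite addn_gt0 h1. Qed.

(** This is [3 log_3 n <= ||n||] in integer form. For sums, [a + b <= a * b] when both summands are
    at least 2; adding 1 to [a >= 3] multiplies the cube by at most 3, and the cases [a <= 2] are
    checked directly. *)
Lemma value_cube (e : expr) : (value e ^ 3 <= 3 ^ ones e)%N.
Proof.
elim: e => //= e1 h1 e2 h2; last first.
  by rewrite expnMn expnD leq_mul.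
have half (a b p q : nat) : (0 < b)%N -> (0 < p)%N -> (0 < q)%N ->
    (b <= a)%N -> (a ^ 3 <= 3 ^ p)%N -> (b ^ 3 <= 3 ^ q)%N ->
    ((a + b) ^ 3 <= 3 ^ (p + q))%N.
  move=> b0 p0 q0 ba ha hb.
  case: b b0 ba hb => // -[_ a1 _|b _ ba hb]; last first.
    have ab : (a + b.+2 <= a * b.+2)%N by nia.
    apply: (@leq_trans ((a * b.+2) ^ 3)%N); first by rewrite leq_exp2r.
    by rewrite expnMn expnD leq_mul.
  have [a3|a3] := leqP 3 a.
    apply: (@leq_trans (3 ^ p * 3)%N); last first.
      by rewrite expnD leq_mul // -[X in (X <= _)%N](expn1 3) leq_exp2l.
    apply: (@leq_trans (a ^ 3 * 3)%N); last by rewrite leq_mul2r ha orbT.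
    by rewrite !expnS !expn0; nia.
  case: a a1 a3 ha => // -[_ _ _|[_ _|//]].
    apply: (@leq_trans (3 ^ 2)%N); [by [] | rewrite leq_exp2l //; lia].
  case: p p0 => // -[//|p _] _.
  apply: (@leq_trans (3 ^ 3)%N); [by [] | rewrite leq_exp2l //; lia].
have [v|v] := leqP (value e2) (value e1).
  by apply: half => //; rewrite ?value_gt0 ?ones_gt0.
rewrite addnC (addnC (ones e1)).
by apply: half => //; rewrite ?value_gt0 ?ones_gt0 // ltnW.
Qed.

Lemma value_gt1_ones (e : expr) : (1 < value e)%N -> (1 < ones e)%N.
Proof.
by case: e => //= e1 e2 _; rewrite -addn1 leq_add // ones_gt0.
Qed.

Lemma complexity_expr (n : nat) : (0 < n)%N ->
  exists e, value e = n /\ ones e = complexity n.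
Proof. by move=> /complexityP[]. Qed.

Lemma complexity_le (e : expr) : (complexity (value e) <= ones e)%N.
Proof. by have [_] := complexityP (value_gt0 e); apply. Qed.

Lemma complexity_gt0 (n : nat) : (0 < n)%N -> (0 < complexity n)%N.
Proof. by move=> /complexity_expr[e [_ <-]]; exact: ones_gt0. Qed.

Lemma complexity_gt1 (n : nat) : (1 < n)%N -> (1 < complexity n)%N.
Proof.
move=> n1; have [e [en <-]] := complexity_expr (ltnW n1).
by apply: value_gt1_ones; rewrite en.
Qed.

Lemma complexity_cube (n : nat) : (0 < n)%N -> (n ^ 3 <= 3 ^ complexity n)%N.
Proof. by move=> /complexity_expr[e [<- <-]]; exact: value_cube. Qed.

Lemma complexityD (m n : nat) : (0 < m)%N -> (0 < n)%N ->
  (complexity (m + n) <= complexity m + complexity n)%N.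
Proof.
move=> /complexity_expr[e [<- <-]] /complexity_expr[f [<- <-]].
exact: (complexity_le (Add e f)).
Qed.

Lemma complexityM (m n : nat) : (0 < m)%N -> (0 < n)%N ->
  (complexity (m * n) <= complexity m + complexity n)%N.
Proof.
move=> /complexity_expr[e [<- <-]] /complexity_expr[f [<- <-]].
exact: (complexity_le (Mul e f)).
Qed.

Lemma complexity1 : complexity 1 = 1%N.
Proof.
by apply/eqP; rewrite eqn_leq (complexity_le One) complexity_gt0.
Qed.

Lemma complexity3 : complexity 3 = 3%N.
Proof.
apply/eqP; rewrite eqn_leq (complexity_le (Add One (Add One One))) /=.
by have := complexity_cube (isT : (0 < 3)%N); rewrite leq_exp2l.
Qed.

Lemma complexityM3 (n k : nat) : (0 < n)%N ->
  (complexity (n * 3 ^ k) <= complexity n + 3 * k)%N.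
Proof.
move=> n0; elim: k => [|k IH]; first by rewrite muln1 muln0 addn0.
rewrite expnS mulnCA (leq_trans (complexityM _ _)) ?muln_gt0 ?n0 ?expn_gt0 //.
by rewrite complexity3 mulnS addnCA leq_add2l.
Qed.

Lemma complexity_le_value (n M : nat) : (0 < n)%N -> (complexity n <= M)%N ->
  (n <= 3 ^ M)%N.
Proof.
move=> n0 nM; apply: (@leq_trans (n ^ 3)%N).
  by rewrite -{1}(expn1 n) leq_pexp2l.
by rewrite (leq_trans (complexity_cube n0)) // leq_exp2l.
Qed.

Lemma complexity_split (n : nat) : (1 < n)%N ->
  (exists a b, [/\ (0 < b <= a)%N, n = (a + b)%N &
     complexity n = (complexity a + complexity b)%N]) \/
  (exists u v, [/\ (1 < u < n)%N, (1 < v < n)%N, n = (u * v)%N &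
     complexity n = (complexity u + complexity v)%N]).
Proof.
move=> n1; have [[//|e1 e2|e1 e2] [/= en on]] := complexity_expr (ltnW n1).
- by rewrite -en in n1.
- left; have := complexityD (value_gt0 e1) (value_gt0 e2).
  have := complexity_le e1; have := complexity_le e2; rewrite en => h2 h1 h.
  have [v|v] := leqP (value e2) (value e1).
    exists (value e1), (value e2); split=> //; last by lia.
    by rewrite value_gt0.
  exists (value e2), (value e1); split=> //; last by lia.
    by rewrite value_gt0 ltnW.
  by rewrite addnC.
right; have := complexityM (value_gt0 e1) (value_gt0 e2).
have := complexity_le e1; have := complexity_le e2; rewrite en => h2 h1 h.
have o1 := ones_gt0 e1; have o2 := ones_gt0 e2.
(* A factor 1 could be dropped, giving a cheaper expression of [n]. *)
have v1 : (1 < value e1)%N.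
  rewrite ltn_neqAle value_gt0 andbT; apply/eqP => e.
  by move: en; rewrite -e mul1n => en; rewrite -en in h2 on; lia.
have v2 : (1 < value e2)%N.
  rewrite ltn_neqAle value_gt0 andbT; apply/eqP => e.
  by move: en; rewrite -e muln1 => en; rewrite -en in h1 on; lia.
by exists (value e1), (value e2); split=> //; rewrite ?v1 ?v2; nia.
Qed.

Definition stable (n : nat) : Prop :=
  (0 < n)%N /\ forall k, complexity (n * 3 ^ k) = (complexity n + 3 * k)%N.

(** The excess [d k] is minimal at some [K]; beyond [K] it cannot fall, and [complexityM3] keeps it
    from rising. By [complexity_cube] the truncated subtraction in [d] is exact. *)
Lemma exists_stable (n : nat) : (0 < n)%N -> exists K, stable (n * 3 ^ K).
Proof.
move=> n0; pose d k := (complexity (n * 3 ^ k) - 3 * k)%N.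
have pos k : (0 < n * 3 ^ k)%N by rewrite muln_gt0 n0 expn_gt0.
have dE k : complexity (n * 3 ^ k) = (d k + 3 * k)%N.
  rewrite subnK // -(@leq_exp2l 3) // mulnC expnM.
  by rewrite (leq_trans _ (complexity_cube (pos k))) // leq_exp2r // leq_pmull.
have exd : exists m, `[< exists k, d k = m >].
  by exists (d 0%N); apply/asboolP; exists 0%N.
case: (ex_minnP exd) => m /asboolP[K dK] mmin; exists K; split=> // k.
have := complexityM3 k (pos K).
rewrite -mulnA -expnD !dE => h; have : (m <= d (K + k))%N.
  by apply: mmin; apply/asboolP; exists (K + k)%N.
lia.
Qed.

(** * Logarithms, and the structure of numbers of bounded defect *)

Section Defect.
Variable R : realType.

(** This is the full term [3 log_3 x] subtracted in the defect, not the logarithm to base 3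
    itself. *)
Definition log3 (x : R) : R := 3 * (ln x / ln 3).

Lemma ln3_gt0 : 0 < ln 3 :> R.
Proof. by rewrite ln_gt0 // ltr1n. Qed.

Lemma log3M (x y : R) : 0 < x -> 0 < y -> log3 (x * y) = log3 x + log3 y.
Proof. by move=> x0 y0; rewrite /log3 lnM ?posrE //; ring. Qed.

Lemma log3X (k : nat) : log3 (3 ^+ k) = 3 * k%:R.
Proof.
have := ln3_gt0 => l3.
by rewrite /log3 lnXn // -[ln 3 *+ _]mulr_natl -(mulrA k%:R) divff ?mulr1 // gt_eqF.
Qed.

Lemma ler_log3 (x y : R) : 0 < x -> x <= y -> log3 x <= log3 y.
Proof.
have := ln3_gt0 => l3 x0 xy; have y0 := lt_le_trans x0 xy.
by rewrite /log3 ler_pM2l // ler_pM2r ?invr_gt0 // ler_ln ?posrE.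
Qed.

Lemma ltr_log3 (x y : R) : 0 < x -> x < y -> log3 x < log3 y.
Proof.
have := ln3_gt0 => l3 x0 xy; have y0 := lt_trans x0 xy.
by rewrite /log3 ltr_pM2l // ltr_pM2r ?invr_gt0 // ltr_ln ?posrE.
Qed.

(** With [log3X], this reduces comparisons between [log3] and integers to inequalities in natural
    numbers. *)
Lemma log3_cube (x : R) : 0 < x -> 3 * log3 x = log3 (x ^+ 3).
Proof. by move=> x0; rewrite /log3 lnXn // -[ln x *+ _]mulr_natl; ring. Qed.

Lemma cvg_log3 (T : Type) (F : set_system T) {FF : Filter F} (f : T -> R)
  (a : R) : 0 < a -> f @ F --> a -> (log3 \o f) @ F --> log3 a.
Proof.
move=> a0 fa; apply: (cvg_comp _ _ fa) => /=.
apply: cvgMl_tmp; apply: cvgMr_tmp; exact: continuous_ln.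
Qed.

Lemma defectE (n : nat) : defect R n = (complexity n)%:R - log3 n%:R.
Proof. by []. Qed.

Lemma defect_ge0 (n : nat) : (0 < n)%N -> 0 <= defect R n.
Proof.
move=> n0; rewrite defectE subr_ge0 -(ler_pM2l (ltr0n _ 3)) log3_cube ?ltr0n //.
by rewrite -log3X ler_log3 ?exprn_gt0 ?ltr0n // -!natrX ler_nat complexity_cube.
Qed.

Lemma defectM (u v n : nat) : (0 < u)%N -> (0 < v)%N -> n = (u * v)%N ->
  complexity n = (complexity u + complexity v)%N ->
  defect R n = defect R u + defect R v.
Proof.
by move=> u0 v0 -> cn; rewrite !defectE cn natrM natrD log3M ?ltr0n //; ring.
Qed.

(* The defect of [2]; it is the smallest positive defect. *)
Definition defect_unit : R := 2 - log3 2.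

Lemma defect_unit_gt0 : 0 < defect_unit.
Proof.
rewrite subr_gt0 -(ltr_pM2l (ltr0n _ 3)) log3_cube // -log3X.
by apply: ltr_log3; rewrite ?exprn_gt0 // -!natrX ltr_nat.
Qed.

Lemma defect1_ge : defect_unit <= defect R 1.
Proof.
have h : 1 <= log3 2.
  rewrite -(ler_pM2l (ltr0n _ 3)) log3_cube // -(log3X 1).
  by apply: ler_log3; rewrite -?natrX ?ltr0n ?ler_nat.
by rewrite defectE complexity1 /log3 ln1 mul0r mulr0 /defect_unit; lra.
Qed.

(** As [n <= 2 a], passing from [a] to [n] raises [log3] by at most [log3 2], while the cost rises
    by [complexity b]. This suffices for [b >= 2]; for [b = 1] the claim becomes
    [3 (a + 1)^3 <= 8 a^3], which holds from [a = 3] on. *)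
Lemma defectD_ge (a b n : nat) : (0 < b <= a)%N -> (3 < n)%N ->
  n = (a + b)%N -> complexity n = (complexity a + complexity b)%N ->
  defect R a + defect_unit <= defect R n /\
  (complexity b)%:R <= defect R n + log3 2.
Proof.
move=> /andP[b0 ba] n3 nE cn.
have a0 : (0 < a)%N by exact: leq_trans ba.
have dn : defect R n = defect R a + (complexity b)%:R - (log3 n%:R - log3 a%:R).
  by rewrite !defectE cn natrD; ring.
have ln2 : log3 n%:R - log3 a%:R <= log3 2.
  rewrite lerBlDr -log3M ?ltr0n // ler_log3 ?ltr0n // ?(ltn_trans _ n3) //.
  by rewrite -natrM ler_nat nE mul2n -addnn leq_add2l.
split; last by have := defect_ge0 a0; rewrite dn; lra.
have [b1|b1] := leqP 2 b.
  have : (2 <= complexity b)%N by exact: complexity_gt1.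
  by rewrite -(ler_nat R) dn /defect_unit => h; lra.
have {b1} bE : b = 1%N by lia.
rewrite dn bE complexity1 /defect_unit.
suff : 1 + log3 n%:R <= log3 a%:R + log3 2 by lra.
rewrite -(ler_pM2l (ltr0n _ 3)) !mulrDr !log3_cube ?ltr0n // ?(ltn_trans _ n3) //.
rewrite -(log3X 1) -!log3M ?exprn_gt0 ?ltr0n // ?(ltn_trans _ n3) //.
apply: ler_log3; first by rewrite mulr_gt0 ?exprn_gt0 ?ltr0n // (ltn_trans _ n3).
rewrite -!natrX -!natrM ler_nat.
have a3 : (3 <= a)%N by lia.
rewrite nE bE expn1 !expnS !expn0 !muln1; nia.
Qed.

(** A sum of value at least 4 has too large a defect by [defectD_ge], so beyond 3 only products
    occur, and both factors are again small. *)
Lemma defect_small (n : nat) : (0 < n)%N -> defect R n < defect_unit ->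
  exists2 p, n = (3 ^ p)%N & complexity n = (3 * p)%N /\ (0 < p)%N.
Proof.
elim/ltn_ind: n => n IH n0 dn.
case: n IH n0 dn => [//|[_ _|[_ _|[_ _ _|n IH n0 dn]]]].
- by rewrite ltNge defect1_ge.
- rewrite ltNge lerB // ler_nat; exact: complexity_gt1.
- by exists 1%N => //; rewrite complexity3.
have [[a [b [ba nE cn]]]|[u [v [hu hv nE cn]]]] := complexity_split (isT : (1 < n.+4)%N).
  have [h _] := defectD_ge ba (isT : (3 < n.+4)%N) nE cn.
  have := @defect_ge0 a; have : (0 < a)%N by lia.
  by move=> -> /(_ isT); lra.
have u0 : (0 < u)%N by lia.
have v0 : (0 < v)%N by lia.
have := defectM u0 v0 nE cn; have := defect_ge0 u0; have := defect_ge0 v0 => dv du duv.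
have [|p up [cp p0]] := IH u (proj2 (andP hu)) u0; first by lra.
have [|q vq [cq q0]] := IH v (proj2 (andP hv)) v0; first by lra.
exists (p + q)%N; first by rewrite nE up vq expnD.
by split; lia.
Qed.

(** The bound [M] leaves finitely many values for [b], so that an ultrafilter can fix it. *)
Definition add_split (s M : R) (m a b : nat) : Prop :=
  [/\ (0 < b <= a)%N, m = (a + b)%N,
    complexity m = (complexity a + complexity b)%N,
    defect R a < s & (complexity b)%:R < M].

Definition mul_split (s : R) (m u v : nat) : Prop :=
  [/\ (0 < u)%N /\ (0 < v)%N, m = (u * v)%N,
    complexity m = (complexity u + complexity v)%N,
    defect R u < s & defect R v < s].

(** Factors of defect below [defect_unit] are powers of 3 and are collected in [3 ^ l]. Once both
    factors have defect at least [defect_unit], additivity makes each lose one unit from the bound;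
    the larger summand of an addition loses one by [defectD_ge]. *)
Lemma defect_structure (k n : nat) : (0 < n)%N ->
  defect R n < k.+1%:R * defect_unit ->
  exists l m, [/\ n = (m * 3 ^ l)%N, complexity n = (complexity m + 3 * l)%N,
    (0 < m)%N &
    [\/ (m <= 3)%N,
      exists a b, add_split (k%:R * defect_unit)
                    (k.+1%:R * defect_unit + log3 2) m a b |
      exists u v, mul_split (k%:R * defect_unit) m u v]].
Proof.
have d0 := defect_unit_gt0.
elim/ltn_ind: n => n IH n0 dn.
have kS : k.+1%:R = k%:R + 1 :> R by rewrite -natr1.
have [n3|n3] := leqP n 3.
  by exists 0%N, n; split; rewrite ?muln1 ?muln0 ?addn0 //; constructor 1.
have n1 : (1 < n)%N by lia.
have [[a [b [ba nE cn]]]|[u [v [hu hv nE cn]]]] := complexity_split n1.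
  have [h1 h2] := defectD_ge ba n3 nE cn.
  exists 0%N, n; split; rewrite ?muln1 ?muln0 ?addn0 //; constructor 2.
  exists a, b; split=> //; first by move: h1 dn; rewrite kS mulrDl mul1r; lra.
  by lra.
have u0 : (0 < u)%N by lia.
have v0 : (0 < v)%N by lia.
have := defectM u0 v0 nE cn; have := defect_ge0 u0; have := defect_ge0 v0 => dv du duv.
have [dus|dus] := ltP (defect R u) defect_unit.
  have [p up [cp p0]] := defect_small u0 dus.
  have [|l [m [vE cv m0 H]]] := IH v (proj2 (andP hv)) v0; first by lra.
  exists (l + p)%N, m; split=> //; last by lia.
  by rewrite nE vE up expnD; lia.
have [dvs|dvs] := ltP (defect R v) defect_unit.
  have [p vp [cp p0]] := defect_small v0 dvs.
  have [|l [m [uE cu m0 H]]] := IH u (proj2 (andP hu)) u0; first by lra.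
  exists (l + p)%N, m; split=> //; last by lia.
  by rewrite nE uE vp expnD; lia.
exists 0%N, n; split; rewrite ?muln1 ?muln0 ?addn0 //; constructor 3.
by exists u, v; split=> //; move: dn; rewrite kS mulrDl mul1r; lra.
Qed.

End Defect.

(** * Tame sequences along an ultrafilter *)

Lemma exp3_gt0 (R : realType) (k : nat) : 0 < 3 ^+ k :> R.
Proof. exact: exprn_gt0. Qed.

Lemma exp3_neq0 (R : realType) (k : nat) : 3 ^+ k != 0 :> R.
Proof. by rewrite gt_eqF // exp3_gt0. Qed.

Lemma cvg_invX3 (R : realType) (F : set_system nat) {FF : Filter F}
    (K : nat -> nat) (b : R) :
  (forall N, \forall j \near F, (N <= K j)%N) ->
  (fun j => b / 3 ^+ K j) @ F --> (0 : R).
Proof.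
move=> Kinf; rewrite -(mulr0 b); apply: cvgMl_tmp.
apply/cvgrPdist_lt => e e0.
near=> j; rewrite sub0r normrN ger0_norm ?invr_ge0 ?ltW ?exp3_gt0 //.
have h : (Num.bound e^-1 <= K j)%N by near: j; exact: Kinf.
rewrite -[e]invrK ltf_pV2 ?posrE ?invr_gt0 ?exp3_gt0 //.
apply: lt_le_trans (archi_boundP _) _; first by rewrite invr_ge0 ltW.
rewrite -natrX ler_nat (leq_trans h) // ltnW //; exact: ltn_expl.
Unshelve. all: by end_near. Qed.

Section Ultra.
Variable R : realType.
Variables (U : set_system nat) (UU : UltraFilter U).

Let FU : ProperFilter U. Proof. exact: ultra_proper. Qed.

Lemma ultra_split (P Q : nat -> Prop) : (\forall j \near U, P j \/ Q j) ->
  (\forall j \near U, P j) \/ (\forall j \near U, Q j).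
Proof.
move=> PQ; have [|nP] := in_ultra_setVsetC [set j | P j] UU; first by left.
by right; apply: filterS2 PQ nP => j [].
Qed.

Lemma ultra_nat (K : nat -> nat) :
  (exists v, \forall j \near U, K j = v) \/
  (forall N, \forall j \near U, (N <= K j)%N).
Proof.
have [|nex] := pselect (exists v, \forall j \near U, K j = v); [by left|right].
elim=> [|N IH]; first by near=> j.
have [nN|h] : (\forall j \near U, K j = N) \/ (\forall j \near U, (N < K j)%N).
- by apply: ultra_split; apply: filterS IH => j; rewrite leq_eqVlt => /orP[/eqP->|]; [left|right].
- by case: nex; exists N.
- exact: h.
Unshelve. all: by end_near. Qed.

Lemma ultra_bounded (K : nat -> nat) (M : nat) :
  (\forall j \near U, (K j <= M)%N) -> exists v, \forall j \near U, K j = v.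
Proof.
move=> KM; have [//|/(_ M.+1) h] := ultra_nat K.
have [j [/= h1 h2]] := filter_ex (filterI KM h).
by move: h2; rewrite ltnNge h1.
Qed.

(* [n j / 3 ^ K j] tends to [a] from above, while the cost [c j] is
   [C + 3 K j]; hence [c j - 3 log_3 (n j)] tends to [C - 3 log_3 a] from below. *)
Definition asymptotic (n c : nat -> nat) (a C : nat) (K : nat -> nat) : Prop :=
  [/\ (0 < a)%N, (complexity a <= C)%N,
    \forall j \near U, c j = (C + 3 * K j)%N /\ (a * 3 ^ K j <= n j)%N,
    (fun j => (n j)%:R / 3 ^+ K j : R) @ U --> (a%:R : R) &
    (complexity a < C)%N \/ \forall j \near U, n j = (a * 3 ^ K j)%N].

Definition tame (n c : nat -> nat) : Prop := exists a C K, asymptotic n c a C K.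

Lemma tame_near (n c n' c' : nat -> nat) :
  (\forall j \near U, n j = n' j /\ c j = c' j) -> tame n c -> tame n' c'.
Proof.
move=> E [a [C [K [a0 aC cK nK H]]]]; exists a, C, K; split=> //.
- by apply: filterS2 E cK => j [-> ->].
- apply: cvg_trans nK; apply: near_eq_cvg.
  by apply: filterS E => j [->].
- by case: H => [?|H]; [left|right; apply: filterS2 E H => j [->]].
Qed.

Lemma tame_cst (m : nat) : (0 < m)%N ->
  tame (fun=> m) (fun=> complexity m).
Proof.
move=> m0; exists m, (complexity m), (fun=> 0%N); split=> //.
- by apply: filterE => j; rewrite muln0 addn0 muln1.
- by under eq_fun do rewrite expr0 divr1; exact: cvg_cst.
- by right; apply: filterE => j; rewrite muln1.
Qed.

Lemma tameM (n c n' c' : nat -> nat) : tame n c -> tame n' c' ->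
  tame (fun j => n j * n' j)%N (fun j => c j + c' j)%N.
Proof.
move=> [a [C [K [a0 aC cK nK H]]]] [a' [C' [K' [a'0 a'C cK' nK' H']]]].
exists (a * a')%N, (C + C')%N, (fun j => K j + K' j)%N.
have aa := complexityM a0 a'0.
split.
- by rewrite muln_gt0 a0.
- by rewrite (leq_trans aa) // leq_add.
- apply: filterS2 cK cK' => j [-> h] [-> h']; split; first by lia.
  by rewrite expnD mulnACA leq_mul.
- have -> : (fun j => (n j * n' j)%:R / 3 ^+ (K j + K' j) : R) =
      (fun j => (n j)%:R / 3 ^+ K j * ((n' j)%:R / 3 ^+ K' j)).
    by apply/funext => j; rewrite natrM exprD invfM mulrACA.
  by rewrite natrM; exact: cvgM.
case: H => [h|H]; first by left; lia.
case: H' => [h|H']; first by left; lia.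
by right; apply: filterS2 H H' => j -> ->; rewrite expnD mulnACA.
Qed.

Lemma tameM3 (n c l : nat -> nat) : tame n c ->
  tame (fun j => n j * 3 ^ l j)%N (fun j => c j + 3 * l j)%N.
Proof.
move=> [a [C [K [a0 aC cK nK H]]]]; exists a, C, (fun j => K j + l j)%N.
split=> //.
- apply: filterS cK => j [-> h]; split; first by lia.
  by rewrite expnD mulnA leq_mul.
- apply: cvg_trans nK; apply: near_eq_cvg; apply: filterE => j.
  rewrite natrM natrX exprD invfM mulrACA divff ?mulr1 //; exact: exp3_neq0.
- by case: H => [?|H]; [left|right; apply: filterS H => j ->; rewrite expnD mulnA].
Qed.

(** If [K] is constant along [U], so is [n], and the sum is a constant sequence. Otherwise [K] tends
    to infinity, so [b] disappears from the limit [a], while [C] grows by [complexity b > 0] and the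
    inequality becomes strict. *)
Lemma tame_addr (n c : nat -> nat) (b : nat) : (0 < b)%N -> tame n c ->
  tame (fun j => n j + b)%N (fun j => c j + complexity b)%N.
Proof.
move=> b0 [a [C [K [a0 aC cK nK H]]]].
have [[k Kk]|Kinf] := ultra_nat K.
  have cvgk : (fun j => (n j)%:R : R) @ U --> ((a * 3 ^ k)%:R : R).
    rewrite natrM natrX.
    apply: cvg_trans (cvgM nK (cvg_cst (3 ^+ k : R))); apply: near_eq_cvg.
    by apply: filterS Kk => j /= ->; rewrite mulfVK // exp3_neq0.
  (* The [n j] are integers bounded below by their limit [a * 3 ^ k], and less than 1 away from
     it. *)
  have nE : \forall j \near U, n j = (a * 3 ^ k)%N.
    move/cvgrPdist_lt : cvgk => /(_ 1 ltr01) h.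
    apply: filterS3 h cK Kk => j + [_ +] kj; rewrite kj.
    rewrite distrC => + le; rewrite ger0_norm ?subr_ge0 ?ler_nat //.
    rewrite -natrB // (ltr_nat _ _ 1); lia.
  exists (a * 3 ^ k + b)%N, (C + 3 * k + complexity b)%N, (fun=> 0%N).
  have aP : (0 < a * 3 ^ k)%N by rewrite muln_gt0 a0 expn_gt0.
  split.
  - by rewrite addn_gt0 aP.
  - rewrite (leq_trans (complexityD aP b0)) // leq_add2r.
    by rewrite (leq_trans (complexityM3 _ a0)) // leq_add2r.
  - by apply: filterS3 cK Kk nE => j [-> _] -> ->; rewrite muln0 addn0 muln1.
  - apply: (@cvg_trans _ ((fun=> (a * 3 ^ k + b)%:R : R) @ U)); last exact: cvg_cst.
    apply: near_eq_cvg.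
    by apply: filterS nE => j /= ->; rewrite expr0 divr1.
  - by right; apply: filterS nE => j ->; rewrite muln1.
exists a, (C + complexity b)%N, K.
have cb := complexity_gt0 b0.
split=> //.
- by rewrite (leq_trans aC) // leq_addr.
- by apply: filterS cK => j [-> h]; split; lia.
- have -> : (fun j => (n j + b)%:R / 3 ^+ K j : R) =
      (fun j => (n j)%:R / 3 ^+ K j + b%:R / 3 ^+ K j).
    by apply/funext => j; rewrite natrD mulrDl.
  by rewrite -[X in _ --> X]addr0; apply: cvgD nK _; exact: cvg_invX3.
- by left; lia.
Qed.

(** The ultrafilter selects one alternative of [defect_structure]; the pieces of unbounded size obey
    the bound for [k], and tameness is preserved by reassembling them. *)
Lemma tame_defect (k : nat) (n : nat -> nat) :
  (\forall j \near U, (0 < n j)%N /\ defect R (n j) < k%:R * defect_unit R) ->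
  tame n (complexity \o n).
Proof.
elim: k n => [|k IH] n hn.
  have [j [n0]] := filter_ex hn.
  by rewrite mul0r ltNge defect_ge0.
set s := k%:R * defect_unit R in IH *.
set M := k.+1%:R * defect_unit R + log3 2.
have /choice[l /choice[m lm]] j : exists l m, (0 < n j)%N ->
  defect R (n j) < k.+1%:R * defect_unit R ->
  [/\ n j = (m * 3 ^ l)%N, complexity (n j) = (complexity m + 3 * l)%N,
    (0 < m)%N &
    [\/ (m <= 3)%N, exists a b, add_split s M m a b |
      exists u v, mul_split s m u v]].
  have [n0|_] := ltnP 0%N (n j); last by exists 0%N, 0%N.
  have [dn|_] := ltP (defect R (n j)) (k.+1%:R * defect_unit R); last by exists 0%N, 0%N.
  by have [l [m H]] := defect_structure n0 dn; exists l, m.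
apply: (@tame_near (fun j => m j * 3 ^ l j)%N (fun j => complexity (m j) + 3 * l j)%N).
  by apply: filterS hn => j [n0 dn]; have [nE cE _ _] := lm j n0 dn; rewrite /= cE.
apply: tameM3.
have : \forall j \near U, (0 < m j <= 3)%N \/
    ((exists a b, add_split s M (m j) a b) \/ (exists u v, mul_split s (m j) u v)).
  apply: filterS hn => j [n0 dn]; have [_ _ m0 []] := lm j n0 dn.
  - by rewrite m0; left.
  - by right; left.
  - by right; right.
move=> /ultra_split[m3|/ultra_split[hadd|hmul]].
- have [v mv] : exists v, \forall j \near U, m j = v.
    by apply: (@ultra_bounded m 3); apply: filterS m3 => j /andP[].
  have v0 : (0 < v)%N.
    by have [j [/= /andP[m0 _] <-]] := filter_ex (filterI m3 mv).
  by apply: tame_near (tame_cst v0); apply: filterS mv => j ->.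
- have /choice[a /choice[b ab]] j : exists a b,
      (exists a b, add_split s M (m j) a b) -> add_split s M (m j) a b.
    have [[a [b H]]|H] := pselect (exists a b, add_split s M (m j) a b).
      by exists a, b.
    by exists 0%N, 0%N => /H.
  (* Bounded complexity means bounded value, so the smaller summand is constant along [U]. *)
  have bM : \forall j \near U, (b j <= 3 ^ Num.bound M)%N.
    apply: filterS hadd => j /ab[/andP[b0 _] _ _ _ hb].
    apply: complexity_le_value => //.
    rewrite -(ler_nat R) ltW // (lt_trans hb) // archi_boundP //.
    by rewrite ltW // (le_lt_trans _ hb).
  have [v bv] := ultra_bounded bM.
  have v0 : (0 < v)%N.
    by have [j [/= /ab[/andP[+ _] _ _ _ _] <-]] := filter_ex (filterI hadd bv).
  apply: (@tame_near (fun j => a j + v)%N (fun j => complexity (a j) + complexity v)%N).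
    by apply: filterS2 hadd bv => j /ab[_ -> -> _ _] ->.
  apply: tame_addr => //; apply: IH.
  apply: filterS hadd => j /ab[/andP[b0 ba] _ _ da _]; split=> //.
  exact: leq_trans ba.
- have /choice[u /choice[v uv]] j : exists u v,
      (exists u v, mul_split s (m j) u v) -> mul_split s (m j) u v.
    have [[u [v H]]|H] := pselect (exists u v, mul_split s (m j) u v).
      by exists u, v.
    by exists 0%N, 0%N => /H.
  apply: (@tame_near (fun j => u j * v j)%N
      (fun j => complexity (u j) + complexity (v j))%N).
    by apply: filterS hmul => j /uv[_ -> ->].
  by apply: tameM; apply: IH; apply: filterS hmul => j /uv[[? ?] _ _ ? ?].
Qed.

End Ultra.

(* The hypotheses say [a <= (n 3 ^ j + 1) 3 ^ l / 3 ^ K < a + 1 / (n + 1)];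
   dropping the [+ 1] then leaves exactly [a], by integrality. *)
Lemma pow3_rigid (n a j l K : nat) : (0 < n)%N -> (0 < a <= j)%N ->
  (a * 3 ^ K <= (n * 3 ^ j + 1) * 3 ^ l)%N ->
  (n.+1 * ((n * 3 ^ j + 1) * 3 ^ l) < (n.+1 * a + 1) * 3 ^ K)%N ->
  (n * 3 ^ (j + l))%N = (a * 3 ^ K)%N.
Proof.
move=> n0 /andP[a0 aj] lo hi.
have p3 k : (0 < 3 ^ k)%N by rewrite expn_gt0.
have jlt : (j < 3 ^ j)%N by rewrite ltn_expl.
(* If [K <= l], the upper bound is violated, because [a <= j < 3 ^ j]. Otherwise [3 ^ l] cancels and
   [t = K - l] is compared with [j]. *)
have [Kl|lK] := leqP K l.
  move: lo hi; rewrite -(subnK Kl) expnD !mulnA leq_pmul2r // ltn_pmul2r //.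
  have := p3 (l - K)%N; set y := (3 ^ (l - K))%N; set J := (3 ^ j)%N in jlt *.
  move=> y0 _ hi; have h1 : (J <= n * J)%N by rewrite leq_pmull.
  have h2 : (n.+1 * (n * J + 1) <= n.+1 * (n * J + 1) * y)%N by rewrite leq_pmulr.
  have h3 : (n.+1 * (a + 1) <= n.+1 * (n * J + 1))%N by rewrite leq_mul2l; lia.
  by have := leq_ltn_trans (leq_trans h3 h2) hi; lia.
move: lo hi; rewrite -(subnK (ltnW lK)) !expnD !mulnA leq_pmul2r // ltn_pmul2r //.
have : (1 <= K - l)%N by rewrite subn_gt0.
move: (K - l)%N => t t1 lo hi; congr (_ * _)%N.
have [tj|jt] := leqP t j.
  move: lo hi; rewrite -(subnK tj) expnD mulnA.
  have : (3 <= 3 ^ t)%N by rewrite -[X in (X <= _)%N](expn1 3) leq_exp2l.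
  move: (n * 3 ^ (j - t))%N (3 ^ t)%N => Z T T3 lo hi.
  suff -> : Z = a by [].
  apply/eqP; rewrite eqn_leq; apply/andP; split; rewrite leqNgt; apply/negP => h.
    have h1 : ((a + 1) * T <= Z * T)%N by rewrite leq_mul2r; lia.
    have h2 : (n.+1 * ((a + 1) * T) <= n.+1 * (Z * T))%N by rewrite leq_mul2l h1 orbT.
    nia.
  have h1 : ((Z + 1) * T <= a * T)%N by rewrite leq_mul2r; lia.
  nia.
move: lo hi; rewrite -(subnK (ltnW jt)) expnD mulnA.
have : (0 < 3 ^ (t - j))%N by [].
have : (3 <= 3 ^ j)%N by rewrite -[X in (X <= _)%N](expn1 3) leq_exp2l //; lia.
move: (3 ^ (t - j))%N (3 ^ j)%N => Z J J3 Z0 lo hi.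
suff -> : n = (a * Z)%N by [].
have aZn : (a * Z <= n)%N.
  rewrite leqNgt; apply/negP => h.
  have h1 : ((n + 1) * J <= a * Z * J)%N by rewrite leq_mul2r; lia.
  nia.
(* This is where the precision [1 / (n + 1)] is needed: [Z <= n] makes the error [Z / (n + 1)] less
   than 1, so [a * Z < n] is impossible. *)
have Zn : (Z <= n)%N by apply: leq_trans aZn; rewrite leq_pmull.
apply/eqP; rewrite eqn_leq aZn andbT leqNgt; apply/negP => h.
have h1 : ((n.+1 * a + 1) * Z <= n.+1 * n)%N by nia.
have h2 : ((n.+1 * a + 1) * Z * J <= n.+1 * n * J)%N by rewrite leq_mul2r h1 orbT.
nia.
Qed.

(** * The closure of the set of defects and its limit points *)

Section Closure.
Variable R : realType.
Local Notation D := (closure (defects R)).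

Lemma closure_approx (A : set R) (x : R) :
  closure A x <-> forall e, 0 < e -> exists2 y, A y & `|x - y| < e.
Proof.
split=> [clA e e0|H B /nbhs_ballP[e /= e0 eB]].
  by have [y [Ay /= xy]] := clA _ (nbhsx_ballx x e e0); exists y.
by have [y Ay xy] := H e e0; exists y; split=> //; apply: eB.
Qed.

(** The [3 K] in the cost cancels against [log3 (3 ^ K)]; as [log3] is increasing, approach from
    above turns into approach from below. *)
Lemma cvg_defect (U : set_system nat) {UU : UltraFilter U} (n : nat -> nat)
    (a C : nat) (K : nat -> nat) : (forall j, (0 < n j)%N) ->
  asymptotic R U n (complexity \o n) a C K ->
  (fun j => defect R (n j)) @ U --> C%:R - log3 (a%:R : R) /\
  \forall j \near U, defect R (n j) <= C%:R - log3 (a%:R : R).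
Proof.
have FU : ProperFilter U by exact: ultra_proper.
move=> n0 [a0 _ cK nK _].
have dE : \forall j \near U,
    defect R (n j) = C%:R - log3 ((n j)%:R / 3 ^+ K j : R).
  apply: filterS cK => j /= [cj _].
  have := log3M (divr_gt0 (_ : 0 < (n j)%:R) (exp3_gt0 R (K j))) (exp3_gt0 R (K j)).
  rewrite ltr0n n0 mulfVK ?exp3_neq0 // log3X => /(_ isT) h.
  by rewrite defectE cj natrD natrM h; ring.
split.
  apply: (@cvg_trans _ ((fun j => C%:R - log3 ((n j)%:R / 3 ^+ K j : R)) @ U)).
    by apply: near_eq_cvg; apply: filterS dE => j ->.
  apply: cvgB; first exact: cvg_cst.
  by apply: (@cvg_log3 R _ _ _ (fun j => (n j)%:R / 3 ^+ K j)) => //; rewrite ltr0n.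
apply: filterS2 dE cK => j -> [_ h].
rewrite lerB // ler_log3 ?ltr0n //.
by rewrite ler_pdivlMr ?exp3_gt0 // -natrX -natrM ler_nat.
Qed.

Lemma tame_defect_lt (U : set_system nat) {UU : UltraFilter U} (n : nat -> nat)
    (M : R) : (\forall j \near U, (0 < n j)%N /\ defect R (n j) < M) ->
  tame R U n (complexity \o n).
Proof.
have FU : ProperFilter U by exact: ultra_proper.
have d0 := defect_unit_gt0 R.
move=> nM; apply: (@tame_defect R U UU (Num.bound (`|M| / defect_unit R)) n).
apply: filterS nM => j [n0 nM]; split=> //; apply: lt_le_trans nM _.
rewrite (le_trans (ler_norm M)) // -ler_pdivrMr // ltW // archi_boundP //.
by rewrite divr_ge0 // ltW.
Qed.

(** Picks approximating numbers at distance less than [1 / (j + 1)] and passes to an ultrafilter.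
    [P] records from which side they approach; the witness [n] is a term of the sequence, so it
    satisfies [P] and yet has defect at most [x]. *)
Lemma defect_adherent (P : nat -> Prop) (x : R) :
  (forall e, 0 < e -> exists n, [/\ (0 < n)%N, P n & `|x - defect R n| < e]) ->
  exists a C n, [/\ [/\ (0 < a)%N, (complexity a <= C)%N & x = C%:R - log3 a%:R],
    (0 < n)%N, P n, defect R n <= x & (complexity a < C)%N \/ defect R n = x].
Proof.
move=> H; have /choice[n nP] j : exists m, [/\ (0 < m)%N, P m &
    `|x - defect R m| < j.+1%:R^-1].
  by apply: H; rewrite invr_gt0 ltr0n.
have [U [UU sU]] := ultraFilterLemma eventually_filter.
have FU : ProperFilter U by exact: ultra_proper.
have near_lt e : 0 < e -> \forall j \near U, `|x - defect R (n j)| < e.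
  move=> e0; apply: sU; near=> j; have [_ _ /lt_trans->//] := nP j.
  by near: j; exact: near_infty_natSinv_lt (PosNum e0).
have n0 j : (0 < n j)%N by have [] := nP j.
have [a [C [K nK]]] : tame R U n (complexity \o n).
  apply: (@tame_defect_lt _ _ _ (x + 1)); apply: filterS (near_lt _ ltr01) => j xj.
  by split=> //; move: xj; rewrite ltr_norml; lra.
have [dx dle] := cvg_defect n0 nK.
have xE : x = C%:R - log3 (a%:R : R).
  by apply: (cvg_unique _ _ dx) => //; apply/cvgrPdist_lt.
have [a0 aC cK _ nE] := nK.
have : \forall j \near U, (complexity a < C)%N \/ defect R (n j) = x.
  case: nE => [?|nE]; first by apply: filterE => j; left.
  apply: filterS2 nE cK => j nE /= [cE _]; right.
  rewrite defectE cE nE xE natrM natrX log3M ?exp3_gt0 ?ltr0n // log3X natrD natrM.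
  by ring.
move=> /(filterI dle) /filter_ex[j /= [dj aj]].
by exists a, C, (n j); have [_ Pj _] := nP j; split=> //; rewrite xE.
Unshelve. all: by end_near. Qed.

Lemma closure_left_approx (x e : R) : D x -> 0 < e ->
  exists n, [/\ (0 < n)%N, x - e < defect R n & defect R n <= x].
Proof.
move=> /closure_approx Dx e0.
have [|a [C [n [_ n0 Pn nx _]]]] :=
    @defect_adherent (fun n => x - e < defect R n) x.
  move=> e' e'0; have [|_ [n /= n0 <-]] := Dx (Num.min e e').
    by rewrite lt_min e0.
  rewrite lt_min => /andP[h h']; exists n; split=> //.
  by move: h; rewrite ltr_norml; lra.
by exists n.
Qed.

Lemma closure_ge0 (x : R) : D x -> 0 <= x.
Proof.
move=> Dx; rewrite leNgt; apply/negP => x0.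
have [n [n0 _ nx]] := closure_left_approx Dx ltr01.
by have := defect_ge0 R n0; lra.
Qed.

(** An infimum that is not attained would be approximated by defects strictly above it, but
    [defect_adherent] then yields one that is not above it. *)
Lemma closure_min (A : set R) : A `<=` D -> A !=set0 ->
  exists2 m, A m & forall y, A y -> m <= y.
Proof.
move=> AD A0; have lbA : has_lbound A by exists 0 => y /AD /closure_ge0.
have lb y : A y -> inf A <= y by move=> Ay; exact: ge_inf.
have [Ai|nAi] := pselect (A (inf A)); first by exists (inf A).
have [|a [C [n [_ n0 Pn nx _]]]] :=
    @defect_adherent (fun n => inf A < defect R n) (inf A); last first.
  by move: Pn nx; rewrite ltNge => /negbTE ->.
move=> e e0; have [y Ay ye] := inf_adherent e0 (conj A0 lbA).
have iy : inf A < y.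
  by rewrite lt_neqAle lb // andbT; apply/eqP => iy; rewrite iy in nAi.
have [|n [n0 yn ny]] := @closure_left_approx y (y - inf A) (AD _ Ay).
  by rewrite subr_gt0.
by exists n; split=> //; [lra | rewrite ltr_norml; apply/andP; split; lra].
Qed.

(** The cost used here is that of an optimal expression of [n], multiplied by [j] threes, plus 1;
    the left side would be the defect if this were optimal. *)
Lemma naive_defect_lt (n j : nat) : (0 < n)%N ->
  (complexity n + 1 + 3 * j)%:R - log3 (n * 3 ^ j + 1)%:R < defect R n + 1.
Proof.
move=> n0; rewrite defectE [(complexity n + _ + _)%:R]natrD natrD (natrM R 3 j) -log3X.
have := @ltr_log3 R (n * 3 ^ j)%:R (n * 3 ^ j + 1)%:R.
rewrite ltr0n muln_gt0 n0 expn_gt0 ltr_nat addn1 ltnSn => /(_ isT isT).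
by rewrite {1}natrM natrX log3M ?exp3_gt0 ?ltr0n //; lra.
Qed.

Lemma naive_defect_cvg (n : nat) (e : R) : (0 < n)%N -> 0 < e ->
  \forall j \near \oo,
    defect R n + 1 - e < (complexity n + 1 + 3 * j)%:R - log3 (n * 3 ^ j + 1)%:R.
Proof.
move=> n0 e0; have h : (fun j => n%:R^-1 / 3 ^+ j : R) @ \oo --> (0 : R).
  by apply: (@cvg_invX3 _ _ _ id) => N; exists N.
have : log3 (1 + n%:R^-1 / 3 ^+ j : R) @[j --> \oo] --> (0 : R).
  have -> : 0 = log3 1 :> R by rewrite /log3 ln1 mul0r mulr0.
  apply: (@cvg_log3 R _ _ _ (fun j => 1 + n%:R^-1 / 3 ^+ j)) => //.
  by rewrite -[X in _ --> X]addr0; apply: cvgD h; exact: cvg_cst.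
move=> /cvgr_lt /(_ _ e0); apply: filterS => j hj.
have nn0 : n%:R != 0 :> R by rewrite pnatr_eq0 -lt0n.
have -> : (n * 3 ^ j + 1)%:R = n%:R * 3 ^+ j * (1 + n%:R^-1 / 3 ^+ j) :> R.
  rewrite natrD natrM natrX mulrDr mulr1; congr (_ + _).
  by rewrite mulrACA divff // divff ?mulr1 // exp3_neq0.
have p0 : 0 < 1 + n%:R^-1 / 3 ^+ j :> R.
  by rewrite ltr_wpDr // divr_ge0 // ?invr_ge0 // ltW // exp3_gt0.
rewrite !log3M ?mulr_gt0 ?exp3_gt0 ?ltr0n // log3X defectE natrD natrM.
by move: hj; lra.
Qed.

Lemma stable_succ_approx (n : nat) (e : R) : stable n -> 0 < e ->
  exists m, [/\ stable m, defect R n + 1 - e < defect R m &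
    defect R m < defect R n + 1].
Proof.
move=> [n0 stn] e0; pose q j l := ((n * 3 ^ j + 1) * 3 ^ l)%N.
pose c j := (complexity n + 1 + 3 * j)%N.
have p0 j : (0 < n * 3 ^ j + 1)%N by rewrite addn1.
have q0 j l : (0 < q j l)%N by rewrite muln_gt0 p0 expn_gt0.
have cle j : (complexity (n * 3 ^ j + 1) <= c j)%N.
  apply: leq_trans (complexityD _ _) _; rewrite ?muln_gt0 ?n0 ?expn_gt0 //.
  by rewrite complexity1 stn /c; lia.
apply: contrapT => nex.
(* If no [l] made the product cheaper than expected, [n * 3 ^ j + 1] would be stable with its naive
   defect, hence a witness. *)
have bad : \forall j \near \oo, exists l, (complexity (q j l) < c j + 3 * l)%N.
  apply: filterS (naive_defect_cvg n0 e0) => j hj.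
  apply: contrapT => nbad; apply: nex; exists (n * 3 ^ j + 1)%N.
  have good l : (c j + 3 * l <= complexity (q j l))%N.
    by rewrite leqNgt; apply/negP => h; apply: nbad; exists l.
  have cE : complexity (n * 3 ^ j + 1) = c j.
    apply/eqP; rewrite eqn_leq cle /=.
    by have := good 0%N; rewrite muln0 addn0 /q muln1.
  have dE : defect R (n * 3 ^ j + 1) = (c j)%:R - log3 (n * 3 ^ j + 1)%:R.
    by rewrite defectE cE.
  split; rewrite ?dE //; last exact: naive_defect_lt.
  split=> // l; apply/eqP; rewrite eqn_leq complexityM3 // cE; exact: good.
have /choice[l hl] j : exists l, (exists l, (complexity (q j l) < c j + 3 * l)%N) ->
    (complexity (q j l) < c j + 3 * l)%N.
  have [[l h]|nh] := pselect (exists l, (complexity (q j l) < c j + 3 * l)%N).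
    by exists l.
  by exists 0%N => /nh.
have [U [UU sU]] := ultraFilterLemma eventually_filter.
have FU : ProperFilter U by exact: ultra_proper.
have Ubad := sU _ bad.
have [a [C [K [a0 aC cK qK qE]]]] :
    tame R U (fun j => q j (l j)) (complexity \o (fun j => q j (l j))).
  apply: (@tame_defect_lt _ _ _ (defect R n + 1)).
  apply: filterS Ubad => j /hl hj; split=> //.
  apply: le_lt_trans (naive_defect_lt j n0).
  rewrite defectE /q natrM natrX log3M ?exp3_gt0 ?ltr0n // log3X opprD addrA addrAC.
  by rewrite lerB // lerBlDr -natrM -natrD ler_nat ltnW.
(* Convergence to [a] allows the tolerance [1 / (n + 1)] required by [pow3_rigid]. *)
have near_rigid : \forall j \near U, (n * 3 ^ (j + l j))%N = (a * 3 ^ K j)%N.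
  have aj : \forall j \near U, (a <= j)%N by apply: sU; exists a.
  have near_lt : \forall j \near U, (q j (l j))%:R / 3 ^+ K j < a%:R + n.+1%:R^-1 :> R.
    by apply: (cvgr_lt _ qK); rewrite ltrDl invr_gt0 ltr0n.
  apply: filterS3 aj near_lt cK => j aj hq [_ alo].
  apply: pow3_rigid => //; first by rewrite a0.
  have nS : 0 < n.+1%:R :> R by rewrite ltr0n.
  move: hq; rewrite ltr_pdivrMr ?exp3_gt0 // -(ltr_pM2l nS) mulrA mulrDr.
  rewrite divff ?gt_eqF // -natrX -!natrM -(natrD _ _ 1) -natrM ltr_nat.
  by [].
have : \forall j \near U, (complexity a < C)%N \/ q j (l j) = (a * 3 ^ K j)%N.
  by case: qE => [?|]; [apply: filterE => j; left | apply: filterS => j; right].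
move=> /(filterI near_rigid) /(filterI cK) /(filterI Ubad) /filter_ex[j /= H].
case: H => /hl hj [[cE _] [nE aE]].
(* Stability gives [complexity n + 3 (j + l) <= complexity a + 3 K], while badness gives
   [C + 3 K <= complexity n + 3 (j + l)]. So [C <= complexity a], and the remaining equality forces
   [3 ^ l = 0]. *)
have := complexityM3 (K j) a0; rewrite -nE stn.
move: cE hj; rewrite /c => -> hj h.
case: aE => [|qEE]; first by lia.
move: qEE; rewrite -nE /q mulnDl mul1n expnD mulnA => /eqP.
by rewrite -{2}[(n * _ * _)%N]addn0 eqn_add2l expn_eq0.
Qed.

Lemma stable_add_approx (n m : nat) (e : R) : stable n -> 0 < e ->
  exists n', [/\ stable n', defect R n + m.+1%:R - e < defect R n' &
    defect R n' < defect R n + m.+1%:R].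
Proof.
move=> stn; elim: m e => [|m IH] e e0.
  exact: stable_succ_approx.
have e2 : 0 < e / 2 by rewrite divr_gt0.
have [n' [st' lo hi]] := IH _ e2.
have [n2 [st2 lo2 hi2]] := stable_succ_approx st' e2.
exists n2; split=> //; rewrite -(natr1 m.+1); lra.
Qed.

Lemma closure_succ_approx (x e : R) : D x -> 0 < e ->
  exists y, [/\ D y, x + 1 - e < y & y < x + 1].
Proof.
move=> Dx e0; have e2 : 0 < e / 2 by rewrite divr_gt0.
have [n [n0 lo hi]] := closure_left_approx Dx e2.
have [K stK] := exists_stable n0.
(* The defect of [n] exceeds that of its stable multiple by a natural number [m], so a shift by 1 of
   the former is a shift by [m + 1] of the latter. *)
have dE : defect R n = defect R (n * 3 ^ K) +
    (complexity n + 3 * K - complexity (n * 3 ^ K))%:R.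
  rewrite !defectE natrB ?complexityM3 // natrD natrM natrX.
  by rewrite log3M ?exp3_gt0 ?ltr0n // log3X natrM; ring.
move: dE; set m := (_ - _)%N => dE.
have [n' [[n'0 _] lo' hi']] := stable_add_approx m stK e2.
exists (defect R n'); split.
- by apply: subset_closure; exists n'.
- by move: lo'; rewrite -natr1 addrA -dE; lra.
- by move: hi'; rewrite -natr1 addrA -dE; lra.
Qed.

Lemma closure_add (x : R) (m : nat) : D x -> D (x + m%:R).
Proof.
move=> Dx; elim: m => [|m IH]; first by rewrite addr0.
rewrite -natr1 addrA; apply: closed_closure.
apply/closure_approx => e e0.
have [y [Dy lo hi]] := closure_succ_approx IH e0.
by exists y => //; rewrite ltr_norml; apply/andP; split; lra.
Qed.

(** Approximation by defects strictly below [y] excludes equality in [defect_adherent], so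
    [complexity a < C], and [y - 1] is still a defect plus a natural number. *)
Lemma closure_limit_pred (y : R) :
  (forall e, 0 < e -> exists z, [/\ D z, y - e < z & z < y]) -> D (y - 1).
Proof.
move=> H; have [|a [C [n [[a0 aC yE] _ ny _ [{}aC|/eqP]]]]] :=
    @defect_adherent (fun n => defect R n < y) y; last by rewrite lt_eqF.
  move=> e e0; have [z [Dz lo hi]] := H _ e0.
  have [|n [n0 nz zn]] := @closure_left_approx z (z - (y - e)) Dz.
    by lra.
  by exists n; split=> //; [lra | rewrite ltr_norml; apply/andP; split; lra].
have -> : y - 1 = defect R a + (C - (complexity a).+1)%:R.
  by rewrite yE defectE natrB // -natr1; ring.
by apply: closure_add; apply: subset_closure; exists a.
Qed.

End Closure.

(** * Order types and ordinal products *)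

Lemma mono_order_type (T : Type) (ltT : T -> T -> Prop) (A : wotype)
    (f : A -> T) (S : set T) :
  (forall x, ~ ltT x x) -> (forall x y z, ltT x y -> ltT y z -> ltT x z) ->
  (forall a b, wo_lt a b -> ltT (f a) (f b)) -> range f = S ->
  has_order_type ltT S A.
Proof.
move=> irr tr fm fS; exists f; split=> // a b; split=> [/fm //|ab].
case: (wo_total a b) => [//|[abE|/fm ba]]; first by case: (irr (f a)); rewrite {2}abE.
by case: (irr (f a)); exact: tr ba.
Qed.

Lemma mono_ord_eq (A B : wotype) (f : A -> B) :
  (forall a b, wo_lt a b -> wo_lt (f a) (f b)) -> range f = [set: B] ->
  ord_eq A B.
Proof. by apply: mono_order_type => [x|x y z]; [exact: wo_irr|exact: wo_trans]. Qed.

Lemma mono_order_type_real (R : realType) (A : wotype) (f : A -> R) (S : set R) :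
  (forall a b, wo_lt a b -> f a < f b) -> range f = S ->
  has_order_type (fun y z : R => y < z) S A.
Proof.
by apply: mono_order_type => [x|x y z]; [rewrite ltxx|exact: lt_trans].
Qed.

Lemma order_type_trans (T : Type) (ltT : T -> T -> Prop) (S : set T)
    (A B : wotype) :
  has_order_type ltT S A -> ord_eq B A -> has_order_type ltT S B.
Proof.
move=> [f [flt fS]] [g [glt gA]]; exists (f \o g); split=> [a b|].
  by rewrite glt flt.
rewrite -fS; apply/seteqP; split=> [_ [b _ <-]|_ [a _ <-]]; first by exists (g b).
by have [b _ <-] : range g a by [rewrite gA]; exists b.
Qed.

Lemma order_type_unique (R : realType) (S : set R) (A B : wotype) :
  has_order_type (fun y z : R => y < z) S A ->
  has_order_type (fun y z : R => y < z) S B -> ord_eq A B.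
Proof.
move=> [f [flt fS]] [g [glt gS]].
have fSa a : S (f a) by rewrite -fS; exists a.
have gSb b : S (g b) by rewrite -gS; exists b.
have /choice[h hP] a : exists b, g b = f a.
  by have := fSa a; rewrite -gS => -[b _ <-]; exists b.
exists h; split=> [a b|]; first by rewrite flt -!hP -glt.
apply/seteqP; split=> // b _.
have := gSb b; rewrite -fS => -[a _ fa]; exists a => //.
by case: (wo_total (h a) b) => [/glt|[//|/glt]]; rewrite hP fa ltxx.
Qed.

Lemma mul_lt_inv (A B : wotype) (p q : ord_mul A B) : wo_lt p q ->
  wo_lt p.1 q.1 \/ (p.1 = q.1 /\ wo_lt p.2 q.2).
Proof. by case=> *; [left|right]. Qed.

Lemma ord_mulA (A B C : wotype) :
  ord_eq (ord_mul A (ord_mul B C)) (ord_mul (ord_mul A B) C).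
Proof.
apply: (@mono_ord_eq _ (ord_mul (ord_mul A B) C)
  (fun p : ord_mul A (ord_mul B C) => (p.1.1, (p.1.2, p.2)))).
  move=> [[c b] a] [[c' b'] a'] /mul_lt_inv /= [/mul_lt_inv /= [|[-> h]]|[[-> ->] h]].
  - by move=> h; apply: left_slex.
  - by apply: right_slex; apply: left_slex.
  - by apply: right_slex; apply: right_slex.
by apply/seteqP; split=> // -[c [b a]] _; exists ((c, b), a).
Qed.

Lemma ord_mul1 (A : wotype) : ord_eq A (ord_mul ord_one A).
Proof.
apply: (@mono_ord_eq A (ord_mul ord_one A) (fun a => (a, tt))).
  by move=> a b ab; apply: left_slex.
by apply/seteqP; split=> // -[a []] _; exists a.
Qed.

Lemma ord_1mul (A : wotype) : ord_eq A (ord_mul A ord_one).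
Proof.
apply: (@mono_ord_eq A (ord_mul A ord_one) (fun a => (tt, a))).
  by move=> a b ab; apply: right_slex.
by apply/seteqP; split=> // -[[] a] _; exists a.
Qed.

(** * Indexing the closure by ordinals *)

Section Index.
Variable R : realType.
Local Notation D := (closure (defects R)).
Local Notation rlt := (fun y z : R => y < z).

Lemma closure_subset_wf (A : set R) : A `<=` D ->
  well_founded (fun y z : {y : R | y \in A} => val y < val z).
Proof.
move=> AD y0; apply: contrapT => nacc0.
pose N := [set y : R | exists2 u : {y : R | y \in A}, val u = y &
  ~ Acc (fun y z : {y : R | y \in A} => val y < val z) u].
have [||m [u um nacc] mmin] := @closure_min R N.
- by move=> _ [[y yA] <- _]; apply: AD; exact/set_mem.
- by exists (val y0), y0.
apply: nacc; split=> v vu; apply: contrapT => naccv.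
have : N (val v) by exists v.
by move=> /mmin; rewrite -um leNgt vu.
Qed.

Lemma closure_subset_order_type (A : set R) : A `<=` D ->
  exists B, has_order_type rlt A B.
Proof.
move=> AD; pose lt (y z : {y : R | y \in A}) := val y < val z.
have lt_tr (y z t : {y : R | y \in A}) : lt y z -> lt z t -> lt y t.
  exact: lt_trans.
have lt_tot (y z : {y : R | y \in A}) : lt y z \/ y = z \/ lt z y.
  case: (ltgtP (val y) (val z)) => h; [by left|by right; right|].
  by right; left; exact: val_inj.
exists (WOType lt_tr lt_tot (closure_subset_wf AD)).
exists val; split=> //; apply/seteqP; split=> [_ [[y yA] _ <-]|y /mem_set yA].
  exact/set_mem.
by exists (exist _ y yA).
Qed.

(* [-1], which lies below the closure, plays the role of the extra first
   element of [1 + B]: 1-indexing in the closure is 0-indexing in this set. *)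
Definition pointed : set R := [set y | D y \/ y = -1].

Definition pointed_below (x : R) : set R := [set y | pointed y /\ y < x].

Lemma pointed_ge (y : R) : pointed y -> -1 <= y.
Proof. by case=> [/closure_ge0|->//]; lra. Qed.

Lemma pointed_gt (y : R) : pointed y -> -1 < y -> D y.
Proof. by case=> [//|->]; rewrite ltxx. Qed.

Lemma closure_nonempty : D !=set0.
Proof. by exists (defect R 1); apply: subset_closure; exists 1%N. Qed.

Lemma order_type_pointed (x : R) (B : wotype) : D x ->
  has_order_type rlt [set y | D y /\ y < x] B ->
  has_order_type rlt (pointed_below x) (ord_add ord_one B).
Proof.
move=> Dx [f [flt fS]].
have fD b : D (f b) /\ f b < x.
  by have : range f (f b) := ex_intro2 _ _ b I erefl; rewrite fS.
apply: (@mono_order_type_real _ _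
  (fun u : ord_add ord_one B => if u is inr b then f b else -1)).
- move=> u v [[] [] //|[] b|a b /flt //].
  by have [/closure_ge0] := fD b; lra.
apply/seteqP; split=> [_ [[u|b] _ <-]|y [[Dy|->] yx]].
- by split; [right | have := closure_ge0 Dx; lra].
- by have [? ?] := fD b; split=> //; left.
- have : range f y by rewrite fS.
  by move=> [b _ <-]; exists (inr b).
- by exists (inl tt).
Qed.

Lemma index1E (A : wotype) (x : R) :
  index1 D A x <-> D x /\ has_order_type rlt (pointed_below x) A.
Proof.
split=> [[B [BA [Dx xB]]]|[Dx xA]].
  split=> //; apply: order_type_trans (ord_eq_sym BA).
  exact: order_type_pointed.
have [|B xB] := @closure_subset_order_type [set y | D y /\ y < x].
  by move=> y [].
exists B; split=> //; apply: order_type_unique xA.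
exact: order_type_pointed.
Qed.

Lemma index1_ord_eq (A B : wotype) (x : R) :
  ord_eq A B -> index1 D A x -> index1 D B x.
Proof.
by move=> AB [C [CA xC]]; exists C; split=> //; exact: ord_eq_trans AB.
Qed.

Lemma pointed_succ (z : R) : pointed z -> exists w,
  [/\ D w, z < w & forall y, pointed y -> z < y -> w <= y].
Proof.
move=> pz; have [||w [Dw zw] wmin] := @closure_min R [set y | D y /\ z < y].
- by move=> y [].
- case: pz => [Dz|->].
    exists (z + 1); split; last by rewrite ltrDl.
    exact: (@closure_add _ z 1).
  have [y Dy] := closure_nonempty; exists y; split=> //.
  by have := closure_ge0 Dy; lra.
exists w; split=> // y py zy; apply: wmin; split=> //.
by apply: pointed_gt py _; apply: le_lt_trans zy; exact: pointed_ge.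
Qed.

(** By [closure_limit_pred], [z] is not a limit from below, so a gap [e] separates it from the
    smaller elements, whose supremum is the predecessor. If there are none, [-1] is. *)
Lemma pointed_pred (z : R) : D z -> ~ D (z - 1) -> exists w,
  [/\ pointed w, w < z & forall y, pointed y -> w < y -> z <= y].
Proof.
move=> Dz nDz1.
have [e e0 he] : exists2 e, 0 < e & forall y, D y -> y < z -> y <= z - e.
  apply: contrapT => nex; apply: nDz1; apply: closure_limit_pred => e e0.
  apply: contrapT => ny; apply: nex; exists e => // y Dy yz.
  by rewrite leNgt; apply/negP => h; apply: ny; exists y.
pose A := [set y | D y /\ y < z].
have [A0|A0] := pselect (A !=set0); last first.
  exists (-1); split; [by right | by have := closure_ge0 Dz; lra|].
  move=> y py y1; rewrite leNgt; apply/negP => yz; apply: A0.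
  by exists y; split=> //; exact: pointed_gt.
have ubA : ubound A (z - e) by move=> y [Dy yz]; exact: he.
have ubA' : has_ubound A by exists (z - e).
exists (sup A); split.
- left; apply: closed_closure.
  apply: (@closureS _ A); first by move=> y [].
  exact: closure_sup.
- by have := ge_sup A0 ubA; lra.
move=> y py Ay; rewrite leNgt; apply/negP => yz.
have : A y.
  split=> //; apply: pointed_gt => //; apply: le_lt_trans Ay.
  have [a Aa] := A0; apply: le_trans (ub_le_sup ubA' Aa).
  by case: Aa => /closure_ge0; lra.
by move=> /(ub_le_sup ubA'); rewrite leNgt Ay.
Qed.

(* The set below [x + 1] is cut by its limit points [y + 1], [y < x], into blocks
   of order type [omega], one for each point of the set below [x]. *)
Lemma index1_omega (A : wotype) (x : R) :
  index1 D A x -> index1 D (ord_mul ord_omega A) (x + 1).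
Proof.
move=> /index1E[Dx [f [flt fS]]]; apply/index1E.
split; first exact: (@closure_add _ x 1).
have /choice[succ succP] (z : R) : exists w, pointed z ->
    [/\ D w, z < w & forall y, pointed y -> z < y -> w <= y].
  have [pz|npz] := pselect (pointed z); last by exists 0.
  by have [w wP] := pointed_succ pz; exists w.
have fP a : pointed (f a) /\ f a < x.
  by have : range f (f a) := ex_intro2 _ _ a I erefl; rewrite fS.
(* The first element of the block of [p]; the added point [-1] starts its own block, all others are
   shifted to a limit point. *)
pose base (p : R) : R := if p == -1 then -1 else p + 1.
have base_lt p q : pointed p -> pointed q -> p < q -> base p < base q.
  move=> pp pq ppq; have := pointed_ge pp => p1.
  rewrite /base (gt_eqF (le_lt_trans p1 ppq)).
  by case: eqP => [E|_]; lra.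
have base_pointed p : pointed p -> pointed (base p).
  rewrite /base; case: eqP => [_ _|pn1 [Dp|//]]; first by right.
  by left; exact: (@closure_add _ p 1).
have iter_pointed i p : pointed p -> pointed (iter i succ p).
  elim: i => //= i IH /IH ip; have [Dw _ _] := succP _ ip; by left.
(* As [y + 1] is a limit from below, finitely many successor steps cannot reach it. *)
have limit_lt z y : pointed z -> D y -> z < y + 1 -> succ z < y + 1.
  move=> pz Dy zy; have [_ _ smin] := succP _ pz.
  have [|w [Dw zw wy]] := @closure_succ_approx _ y (y + 1 - z) Dy.
    by rewrite subr_gt0.
  apply: le_lt_trans wy; apply: smin; [by left | lra].
have iter_lt i p y : pointed p -> D y -> p < y + 1 -> iter i succ p < y + 1.
  move=> pp Dy py; elim: i => //= i IH.
  by apply: limit_lt => //; exact: iter_pointed.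
have iter_mono p i j : pointed p -> (i < j)%N -> iter i succ p < iter j succ p.
  move=> pp; elim: j => // j IH; rewrite ltnS leq_eqVlt.
  have [_ sj _] := succP _ (iter_pointed j _ pp).
  move=> /orP[/eqP->//|/IH h]; exact: lt_trans sj.
pose F (u : ord_mul ord_omega A) := iter u.2 succ (base (f u.1)).
apply: (@mono_order_type_real _ _ F).
  move=> [a i] [b j] /mul_lt_inv /= [ab|[-> ij]]; rewrite /F /=; last first.
    by apply: iter_mono => //; apply: base_pointed; have [] := fP b.
  have [pa _] := fP a; have [pb _] := fP b; move/flt : ab => ab.
  have b1 : -1 < f b by apply: le_lt_trans ab; exact: pointed_ge.
  have bE : base (f b) = f b + 1 by rewrite /base gt_eqF.
  apply: (@lt_le_trans _ _ (f b + 1)).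
    apply: iter_lt; [exact: base_pointed | exact: pointed_gt |].
    by rewrite -bE; exact: base_lt.
  rewrite -bE; case: j => // j; apply/ltW.
  by apply: (@iter_mono _ 0%N); first exact: base_pointed.
apply/seteqP; split=> [_ [[a i] _ <-]|z [pz zx]].
  have [pa ax] := fP a; rewrite /F /=; split.
    by apply: iter_pointed; exact: base_pointed.
  apply: iter_lt => //; first exact: base_pointed.
  rewrite /base; case: eqP => _; last by lra.
  by have := closure_ge0 Dx; lra.
have block p i : pointed p -> p < x -> range F (iter i succ (base p)).
  move=> pp px; have : range f p by rewrite fS.
  by move=> [a _ <-]; exists (a, i).
(* Surjectivity by a least counterexample [m]: if [m - 1] is in the closure, [m] starts a block;
   otherwise [m] is the successor of a point already covered. *)
apply: contrapT => nz.
have [||m [pm mx nm] mmin] :=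
    @closure_min R [set z | [/\ D z, z < x + 1 & ~ range F z]].
- by move=> y [].
- exists z; split=> //; apply: pointed_gt => //.
  rewrite lt_neqAle pointed_ge // andbT; apply/eqP => zE; apply: nz.
  rewrite -zE; have := block (-1) 0%N; rewrite /= /base eqxx; apply; first by right.
  by have := closure_ge0 Dx; lra.
have [Dm1|nDm1] := pselect (D (m - 1)).
  apply: nm; have := block (m - 1) 0%N (or_introl Dm1).
  rewrite /= /base gt_eqF; last by have := closure_ge0 Dm1; lra.
  by rewrite subrK; apply; lra.
have [w [pw wm wmin]] := pointed_pred pm nDm1.
have [Dsw wsw swmin] := succP _ pw.
have swE : succ w = m.
  by apply/eqP; rewrite eq_le swmin //; [exact: wmin (or_introl _) _ | left].
have [[a i] _ aiE] : range F w.
  case: pw => [Dw|->].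
    apply: contrapT => nw; have : m <= w by apply: mmin; split=> //; lra.
    by rewrite leNgt wm.
  have := block (-1) 0%N; rewrite /= /base eqxx; apply; first by right.
  by have := closure_ge0 Dx; lra.
by apply: nm; exists (a, i.+1) => //; rewrite -swE -aiE.
Qed.

(** The induction varies [A], since [omega^(k+1) A] is regrouped as [omega^k (omega A)]. *)
Lemma index1_omega_exp (k : nat) (A : wotype) (x : R) :
  index1 D A x -> index1 D (ord_mul (ord_exp ord_omega k) A) (x + k%:R).
Proof.
elim: k A x => [|k IH] A x xA.
  by rewrite addr0; apply: index1_ord_eq xA; exact: ord_mul1.
rewrite -nat1r addrA; apply: index1_ord_eq (IH _ _ (index1_omega xA)).
exact: ord_mulA.
Qed.

(** The least element [s] has index 1, so [s + n] has index [omega^n]; an ordinal below [omega^n] is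
    an initial segment of it, and the point enumerated at its end [b] has the wanted index. *)
Lemma index1_exists (A : wotype) :
  ord_le ord_one A -> lt_omega_omega A -> exists x : R, index1 D A x.
Proof.
move=> A1 [n [b [h [hlt hb]]]].
have [a0 _] : exists a0 : A, True by case: A1 => [[a _]|[i _]]; [exists a|exists (i tt)].
have [s Ds smin] := closure_min (@subset_refl _ D) closure_nonempty.
have s1 : index1 D ord_one s.
  apply/index1E; split=> //; apply: (@mono_order_type_real _ _ (fun=> -1)) => //.
  apply/seteqP; split=> [_ [u _ <-]|y [[/smin sy|->] ys]].
  - by split; [right|have := closure_ge0 Ds; lra].
  - by move: sy; rewrite leNgt ys.
  - by exists tt.
have /index1E[Dsn [g [glt gS]]] :
    index1 D (ord_exp ord_omega n) (s + n%:R).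
  by apply: index1_ord_eq (index1_omega_exp n s1); apply: ord_eq_sym; exact: ord_1mul.
have gP c : pointed (g c) /\ g c < s + n%:R.
  by have : range g (g c) := ex_intro2 _ _ c I erefl; rewrite gS.
have hlt_b a : wo_lt (h a) b.
  by have : range h (h a) := ex_intro2 _ _ a I erefl; rewrite hb.
exists (g b); apply/index1E; split.
  (* An element [a0] of [A], available because [1 <= A], ensures that [g b] is not the added point
     [-1]. *)
  apply: pointed_gt; first by have [] := gP b.
  apply: (@le_lt_trans _ _ (g (h a0))); last exact/glt.
  by apply: pointed_ge; have [] := gP (h a0).
exists (g \o h); split=> [a a'|]; first by rewrite hlt glt.
apply/seteqP; split=> [_ [a _ <-]|y [py yb]].
  by split; [have [] := gP (h a) | exact/glt].
have [c _ cy] : range g y.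
  by rewrite gS; split=> //; have [_] := gP b; exact: lt_trans.
have [a _ ac] : range h c by rewrite hb; apply/glt; rewrite cy.
by exists a => //=; rewrite ac.
Qed.

End Index.

Theorem theorem1p6 (R : realType) (alpha : wotype) (k : nat)
    (alpha_ge1 : ord_le ord_one alpha) (alpha_lt : lt_omega_omega alpha) :
  exists x : R,
    index1 (closure (defects R)) alpha x /\
    index1 (closure (defects R)) (ord_mul (ord_exp ord_omega k) alpha)
      (x + k%:R).
Proof.
have [x xalpha] := index1_exists R alpha_ge1 alpha_lt.
by exists x; split=> //; exact: index1_omega_exp.
Qed.
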